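(* There is a universal constant $C>0$ such that for every $n\ge2$ and every number $r\ge1$ of particles, the relaxation time $\tau$ of the ZRP with rate $1$ on the complete graph $K_n$ with $r$ particles satisfies $\tau\le C(\rho+1)^2$, where $\rho=r/n$. *)

(* Defs.v *)
From HB Require Import structures.
From mathcomp Require Import all_boot all_order all_algebra.
From mathcomp Require Import all_classical all_reals.
From mathcomp Require Import Rstruct.
Set Implicit Arguments. Unset Strict Implicit. Unset Printing Implicit Defensive.
Import Order.TTheory GRing.Theory Num.Theory.
Local Open Scope ring_scope.
Local Open Scope classical_set_scope.

Definition zrp_state (n r : nat) :=
  {f : {ffun 'I_n -> 'I_r.+1} | (\sum_(i < n) (f i : nat))%N == r}.

Definition occ (n r : nat) (eta : zrp_state n r) (x : 'I_n) : nat := val eta x.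

Definition is_jump (n r : nat) (x y : 'I_n) (eta xi : zrp_state n r) : bool :=
  [&& (0 < occ eta x)%N, occ xi x == (occ eta x).-1,
      occ xi y == (occ eta y).+1 &
      [forall z, (z != x) && (z != y) ==> (occ xi z == occ eta z)]].

(* ZRP with rate 1 on K_n: every nonempty site x emits a particle at rate 1,
   sent to a uniformly chosen other site y <> x (rate 1/(n-1) per y). *)
Definition zrp_rate (R : realType) (n r : nat) (eta xi : zrp_state n r) : R :=
  (#|[set p : 'I_n * 'I_n | (p.1 != p.2) && is_jump p.1 p.2 eta xi]|)%:R
  / (n.-1)%:R.

Definition zrp_generator (R : realType) (n r : nat)
  (f : zrp_state n r -> R) (eta : zrp_state n r) : R :=
  \sum_(xi : zrp_state n r) zrp_rate R eta xi * (f xi - f eta).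

Definition zrp_spectral_gap (R : realType) (n r : nat) : R :=
  inf [set lam : R | lam != 0 /\
        exists f : zrp_state n r -> R,
          (exists eta, f eta != 0) /\
          forall eta, - zrp_generator f eta = lam * f eta].

Definition zrp_relaxation_time (R : realType) (n r : nat) : R :=
  (zrp_spectral_gap R n r)^-1.

(* Main.v *)
Require Import Defs.
From HB Require Import structures.
From mathcomp Require Import all_boot all_order all_algebra.
From mathcomp Require Import all_classical all_reals.
From mathcomp Require Import Rstruct.
From mathcomp Require Import ring lra zify.
Set Implicit Arguments. Unset Strict Implicit. Unset Printing Implicit Defensive.
Import Order.TTheory GRing.Theory Num.Theory.
Local Open Scope ring_scope.

(* Let f be an eigenfunction of -L with eigenvalue lam <> 0 and, for a
   configuration c with r - 1 particles, put
     u_z(c) = f(c + delta_z) - avg_y f(c + delta_y).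
   In c + delta_z the extra particle, served last at its site, moves
   only when c is empty at z, and then to a uniform site. Since
   sum_z u_z(c) = 0, the eigenvalue equation gives the exact identity
     (n-1) lam sum_{c,z} u_z^2
       = sum_{c,z} u_z (-(n-1) L u_z) + n sum_{c,z : c_z = 0} u_z^2,
   so that lam is at least the principal eigenvalue of the process killed at
   rate about 1 while the single site z is empty. That eigenvalue is bounded
   below with the Lyapunov function t^(c_z), t = 1 + 1/(8(q+1)), where q + 1
   is of order rho + 1: only the jumps between z and other sites y are kept,
   with the rates reduced by the factor min(c_y + 1, M) / M, M = 4(q+1). With
   these weights the drift of c_z towards 0 has a deterministic lower bound,
   because at most a quarter of the sites hold M particles or more. *)

(** * Configurations with unbounded counts; adding and removing particles *)

(** Entries are plain naturals so that configurations with different numbers of particles share one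
    type and [addp] stays inside it; [zrp_state n r] depends on [r]. *)
Notation config n := {ffun 'I_n -> nat}.

Definition addp (n : nat) (c : config n) (x : 'I_n) : config n :=
  [ffun i => (c i + (i == x))%N].

Definition remp (n : nat) (c : config n) (x : 'I_n) : config n :=
  [ffun i => (c i - (i == x))%N].

Lemma addpK (n : nat) (c : config n) (x : 'I_n) : remp (addp c x) x = c.
Proof. by apply/ffunP => i; rewrite !ffunE addnK. Qed.

Lemma rempK (n : nat) (c : config n) (x : 'I_n) :
  (0 < c x)%N -> addp (remp c x) x = c.
Proof.
move=> cx; apply/ffunP => i; rewrite !ffunE.
by case: eqVneq => [->|_]; rewrite ?subnK // subn0 addn0.
Qed.

Lemma addpC (n : nat) (c : config n) (x y : 'I_n) :
  addp (addp c x) y = addp (addp c y) x.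
Proof. by apply/ffunP => i; rewrite !ffunE addnAC. Qed.

Lemma addp_remp (n : nat) (c : config n) (x y : 'I_n) :
  (0 < c x)%N -> remp (addp c y) x = addp (remp c x) y.
Proof. by move=> cx; rewrite -{1}(rempK cx) addpC addpK. Qed.

Lemma sum_addp (n : nat) (c : config n) (x : 'I_n) :
  (\sum_i addp c x i)%N = (\sum_i c i).+1.
Proof.
under eq_bigr do rewrite ffunE.
rewrite big_split /= -[RHS]addn1; congr (_ + _)%N.
by rewrite (bigD1 x) //= eqxx big1 // => i /negbTE ->.
Qed.

Lemma sum_move (n : nat) (c : config n) (x y : 'I_n) :
  (0 < c x)%N -> (\sum_i addp (remp c x) y i)%N = (\sum_i c i)%N.
Proof. by move=> cx; rewrite sum_addp -(sum_addp _ x) rempK. Qed.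

Definition config_of (n r : nat) (eta : zrp_state n r) : config n :=
  [ffun x => occ eta x].

Lemma config_of_inj (n r : nat) : injective (@config_of n r).
Proof.
move=> eta xi /ffunP E; apply/val_inj/ffunP => x; apply/val_inj.
by have := E x; rewrite !ffunE.
Qed.

Definition configs (n r : nat) : seq (config n) :=
  [seq config_of eta | eta <- enum {: zrp_state n r}].

Lemma mem_configs (n r : nat) (c : config n) :
  (c \in configs n r) = ((\sum_i c i)%N == r).
Proof.
apply/mapP/eqP => [[eta _ ->]|E].
  by under eq_bigr do rewrite ffunE; apply/eqP/(valP eta).
have le i : (c i <= r)%N by rewrite -E (bigD1 i) //= leq_addr.
pose h : {ffun 'I_n -> 'I_r.+1} := [ffun i => inord (c i)].
have hE i : h i = c i :> nat by rewrite /h ffunE inordK // ltnS le.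
have hr : (\sum_(i < n) (h i : nat))%N == r.
  by apply/eqP; rewrite -[RHS]E; apply: eq_bigr => i _; apply: hE.
exists (exist _ h hr); first by rewrite mem_enum.
by apply/ffunP => i; rewrite ffunE /occ /= hE.
Qed.

Lemma uniq_configs (n r : nat) : uniq (configs n r).
Proof. by rewrite map_inj_uniq ?enum_uniq //; apply: config_of_inj. Qed.

(** Adding a particle at [x] is a bijection onto the configurations occupied at [x]. This expresses
    the reversibility of the uniform measure. *)
Lemma reindex_addp (V : nmodType) (n s : nat) (x : 'I_n) (F : config n -> V) :
  \sum_(c <- configs n s.+1 | (0 < c x)%N) F c =
  \sum_(c <- configs n s) F (addp c x).
Proof.
rewrite -big_filter -(big_map (fun c : config n => addp c x) xpredT F); apply: perm_big.
apply: uniq_perm; first by rewrite filter_uniq ?uniq_configs.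
  rewrite map_inj_uniq ?uniq_configs // => c d.
  by move=> /(congr1 (fun e : config n => remp e x)); rewrite !addpK.
move=> c; rewrite mem_filter mem_configs; apply/andP/mapP => [[cx /eqP E]|[d]].
  exists (remp c x); last by rewrite rempK.
  by rewrite mem_configs -eqSS -(sum_addp _ x) rempK // E.
by rewrite mem_configs => /eqP <- ->; rewrite sum_addp ffunE eqxx addn1.
Qed.

Lemma reindex_addp_sum (V : nmodType) (n s : nat) (F : config n -> 'I_n -> V) :
  \sum_(c <- configs n s.+1) \sum_(x | (0 < c x)%N) F c x =
  \sum_(c <- configs n s) \sum_x F (addp c x) x.
Proof.
under eq_bigr do rewrite big_mkcond /=.
rewrite exchange_big [RHS]exchange_big; apply: eq_bigr => x _.
by rewrite -big_mkcond; apply: (reindex_addp s x (fun c => F c x)).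
Qed.

(** * The generator on configurations and its Dirichlet form *)

(* [n - 1] times minus the generator, for any number of particles; the term
   [y = x] vanishes. *)
Definition zlap (R : realType) (n : nat) (phi : config n -> R) (c : config n) : R :=
  \sum_(x | (0 < c x)%N) \sum_y (phi c - phi (addp (remp c x) y)).

Lemma is_jumpE (n r : nat) (x y : 'I_n) (eta xi : zrp_state n r) :
  x != y -> is_jump x y eta xi =
  (0 < config_of eta x)%N && (config_of xi == addp (remp (config_of eta) x) y).
Proof.
move=> xy; rewrite /is_jump !ffunE; case: posnP => //= cx.
apply/and3P/eqP => [[/eqP Ex /eqP Ey /forallP Ez]|/ffunP E].
  apply/ffunP => z; rewrite !ffunE.
  case: (eqVneq z x) => [->|zx]; first by rewrite (negbTE xy) Ex; lia.
  case: (eqVneq z y) => [->|zy]; first by rewrite Ey; lia.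
  by have := Ez z; rewrite zx zy /= => /eqP ->; lia.
split.
- by have := E x; rewrite !ffunE eqxx (negbTE xy) => ->; lia.
- by have := E y; rewrite !ffunE eqxx eq_sym (negbTE xy) => ->; lia.
apply/forallP => z; apply/implyP => /andP[zx zy].
by have := E z; rewrite !ffunE (negbTE zx) (negbTE zy) => ->; lia.
Qed.

Lemma sum_config_of (V : nmodType) (n r : nat) (F : config n -> V) :
  \sum_(eta : zrp_state n r) F (config_of eta) = \sum_(c <- configs n r) F c.
Proof. by rewrite big_map big_enum. Qed.


(** After exchanging the sums, each pair [x != y] with [x] occupied selects exactly one target
    state. *)
Lemma zrp_generatorE (R : realType) (n r : nat) (phi : config n -> R)
    (eta : zrp_state n r) :
  - zrp_generator (phi \o @config_of n r) eta
  = n.-1%:R^-1 * zlap phi (config_of eta).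
Proof.
set c := config_of eta.
have rateE (xi : zrp_state n r) :
    zrp_rate R eta xi * (phi (config_of xi) - phi c) = n.-1%:R^-1 *
    \sum_x \sum_y (if (x != y) && is_jump x y eta xi
                   then phi (config_of xi) - phi c else 0).
  rewrite /zrp_rate -sum1_card natr_sum mulrAC mulrC; congr (_ * _).
  rewrite mulr_suml big_mkcond pair_bigA /=; apply: eq_bigr => p _.
  by rewrite [p \in _]asboolb mul1r.
rewrite /zrp_generator /= (eq_bigr _ (fun xi _ => rateE xi)) -mulr_sumr -mulrN.
congr (_ * _); rewrite exchange_big -sumrN /zlap [RHS]big_mkcond /=.
apply: eq_bigr => x _; rewrite exchange_big -sumrN.
case: ifPn => [cx|ncx]; last first.
  rewrite big1 // => y _; rewrite big1 ?oppr0 // => xi _.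
  by case: eqVneq => //= xy; rewrite is_jumpE // (negbTE ncx).
apply: eq_bigr => y _.
case: (eqVneq x y) => [<-|xy].
  by rewrite big1 ?oppr0 // rempK // subrr.
under eq_bigr do rewrite is_jumpE //= cx /=.
set d := addp _ y; have dr : d \in configs n r.
  rewrite mem_configs sum_move // -mem_configs.
  by apply: map_f; rewrite mem_enum.
rewrite (sum_config_of r (fun e : config n => if e == d then phi e - phi c else 0)).
rewrite (bigD1_seq d) ?uniq_configs //= eqxx big1 ?addr0 ?opprB //.
by move=> e /negbTE ->.
Qed.

(** A configuration with a marked occupied site is [addp c x], and its jump to [y] gives [addp c y].
    Adding the same sum with [x] and [y] exchanged turns products into squares. *)
Lemma sum_zlap (R : realType) (n s : nat) (phi : config n -> R) :
  2 * \sum_(c <- configs n s.+1) phi c * zlap phi c =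
  \sum_(c <- configs n s) \sum_x \sum_y (phi (addp c x) - phi (addp c y)) ^+ 2.
Proof.
under eq_bigr do rewrite mulr_sumr.
rewrite reindex_addp_sum mulr_sumr; apply: eq_bigr => c _.
under eq_bigr do rewrite addpK mulr_sumr.
rewrite mulr_natl mulr2n [X in X + _]exchange_big -big_split /=.
apply: eq_bigr => x _; rewrite -big_split /=; apply: eq_bigr => y _; ring.
Qed.

Lemma zlap0 (R : realType) (n : nat) (phi : config n -> R) (c : config n) :
  c \in configs n 0 -> zlap phi c = 0.
Proof.
rewrite mem_configs sum_nat_eq0 => /forallP c0.
by rewrite /zlap big1 // => x; rewrite (eqP (c0 x)).
Qed.

(** * Lower bound for the process killed while [z] is empty *)

(* Lyapunov estimate for an edge across which the Lyapunov function has ratio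
   [t]: a supersolution bounds the Dirichlet form from below edge by edge. *)
Lemma sqr_grad_lyapunov (R : realType) (t a b : R) : 0 < t ->
  (1 - t^-1) * a ^+ 2 - (t - 1) * b ^+ 2 <= (a - b) ^+ 2.
Proof.
move=> t0; rewrite -subr_ge0.
suff -> : (a - b) ^+ 2 - ((1 - t^-1) * a ^+ 2 - (t - 1) * b ^+ 2)
  = t^-1 * (a - t * b) ^+ 2 by rewrite mulr_ge0 ?sqr_ge0 ?invr_ge0 ?ltW.
by field; rewrite gt_eqF.
Qed.

(** Of the Dirichlet form only the edges between [addp c z] and [addp c y] are kept, with weight
    [minn (c y).+1 M <= M]; [sqr_grad_lyapunov] is applied to each. The factor [M] on the right
    clears the denominator of the reduced rates. *)
Lemma killed_dirichlet_bound (R : realType) (n s M : nat) (t : R)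
    (phi : config n -> R) (z : 'I_n) :
  (0 < M)%N -> 0 < t ->
  \sum_(c <- configs n s.+1)
    (if (0 < c z)%N then (1 - t^-1) * (\sum_(y | y != z) minn (c y).+1 M)%:R else 0)
      * phi c ^+ 2
  - \sum_(c <- configs n s.+1)
    (t - 1) * (\sum_(y | y != z) minn (c y) M)%:R * phi c ^+ 2
  <= M%:R * \sum_(c <- configs n s.+1) phi c * zlap phi c.
Proof.
move=> M0 t0.
have -> : \sum_(c <- configs n s.+1)
    (if (0 < c z)%N then (1 - t^-1) * (\sum_(y | y != z) minn (c y).+1 M)%:R else 0)
      * phi c ^+ 2
    = \sum_(c <- configs n s) \sum_(y | y != z)
        (minn (c y).+1 M)%:R * ((1 - t^-1) * phi (addp c z) ^+ 2).
  under eq_bigr do rewrite mulrC.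
  rewrite (eq_bigr (fun c : config n => if (0 < c z)%N then phi c ^+ 2 *
    ((1 - t^-1) * (\sum_(y | y != z) minn (c y).+1 M)%:R) else 0)); last first.
    by move=> c _; case: ifP; rewrite ?mulr0.
  rewrite -big_mkcond reindex_addp; apply: eq_bigr => c _.
  rewrite -mulr_suml -natr_sum (eq_bigr (fun y => minn (c y).+1 M)); first by ring.
  by move=> y /negbTE yz; rewrite ffunE yz addn0.
have -> : \sum_(c <- configs n s.+1)
    (t - 1) * (\sum_(y | y != z) minn (c y) M)%:R * phi c ^+ 2
    = \sum_(c <- configs n s) \sum_(y | y != z)
        (minn (c y).+1 M)%:R * ((t - 1) * phi (addp c y) ^+ 2).
  transitivity (\sum_(c <- configs n s.+1) \sum_(y | y != z)
      (minn (c y) M)%:R * ((t - 1) * phi c ^+ 2)).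
    by apply: eq_bigr => c _; rewrite -mulr_suml -natr_sum; ring.
  (* The weight [minn (c y) M] vanishes when [y] is empty, so only configurations of the form
     [addp c y] remain. *)
  rewrite exchange_big [RHS]exchange_big; apply: eq_bigr => y _ /=.
  transitivity (\sum_(c <- configs n s.+1 | (0 < c y)%N)
    (minn (c y) M)%:R * ((t - 1) * phi c ^+ 2)).
    rewrite [RHS]big_mkcond; apply: eq_bigr => c _; case: posnP => [->|//].
    by rewrite min0n mul0r.
  by rewrite reindex_addp; apply: eq_bigr => c _; rewrite ffunE eqxx addn1.
rewrite -sumrB -(ler_pM2l (ltr0n R 2)) mulrCA sum_zlap mulr_sumr [leRHS]mulr_sumr.
apply: ler_sum => c _; rewrite -sumrB.
set G := fun x y => (phi (addp c x) - phi (addp c y)) ^+ 2.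
have G0 x y : 0 <= G x y by apply: sqr_ge0.
have GC x y : G x y = G y x by rewrite /G -sqrrN opprB.
(* Each edge at [z] occurs twice among the ordered pairs, as [(z, y)] and as [(y, z)]. *)
have star_le : 2 * \sum_(y | y != z) G z y <= \sum_x \sum_y G x y.
  rewrite [leRHS](bigD1 z) //= mulr_natl mulr2n.
  apply: lerD; first by rewrite [leRHS](bigD1 z) //= lerDr.
  apply: ler_sum => x _; rewrite (bigD1 z) //= GC lerDl.
  exact: sumr_ge0.
apply: le_trans (ler_wpM2l (ler0n R M) star_le).
rewrite [leRHS]mulrCA ler_pM2l ?ltr0n // mulr_sumr; apply: ler_sum => y _.
rewrite -mulrBr (le_trans (ler_wpM2l (ler0n _ _) (sqr_grad_lyapunov _ _ t0))) //.
by rewrite ler_wpM2r ?G0 // ler_nat geq_minr.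
Qed.

(** The truncated count grows by one unless [c y >= M], and then the [c y] particles at [y] pay for
    the missing [M]: Markov's inequality, site by site. *)
Lemma sum_minnS (n M : nat) (c : config n) (z : 'I_n) : (0 < M)%N ->
  (M * n.-1 + M * \sum_(y | y != z) minn (c y) M <=
   M * \sum_(y | y != z) minn (c y).+1 M + \sum_i c i)%N.
Proof.
move=> M0.
have -> : n.-1 = (\sum_(y < n | y != z) 1)%N.
  by rewrite sum1_card cardC1 card_ord.
rewrite [(\sum_i c i)%N](bigD1 z) //= addnCA (leq_trans _ (leq_addl _ _)) //.
rewrite !big_distrr /= -!big_split /=; apply: leq_sum => y _.
have [cM|Mc] := ltnP (c y) M; first by rewrite (minn_idPl cM) mulnS; lia.
by rewrite (minn_idPr _) ?(leqW Mc) //; lia.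
Qed.

Lemma killed_poincare (R : realType) (n s q : nat) (phi : config n -> R)
    (z : 'I_n) : (2 <= n)%N -> (s < n * q.+1)%N ->
  n%:R / (512 * q.+1%:R ^+ 2) * \sum_(c <- configs n s) phi c ^+ 2 <=
  \sum_(c <- configs n s) phi c * zlap phi c
  + n%:R * \sum_(c <- configs n s | c z == 0%N) phi c ^+ 2.
Proof.
move=> n2 sn; set Q : R := q.+1%:R; set N : R := n%:R.
have Q1 : 1 <= Q by rewrite ler1n.
have Q0 : 0 < Q by apply: lt_le_trans Q1.
have N2 : 2 <= N by rewrite ler_nat.
(* Without particles [zlap] vanishes, but every configuration is empty at [z], so the killing term
   alone suffices. *)
case: s sn => [_|s sn].
  rewrite [X in X + _]big1_seq ?add0r => [|c /zlap0 c0]; last by rewrite c0 mulr0.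
  rewrite [leRHS](_ : _ = N * \sum_(c <- configs n 0) phi c ^+ 2).
    apply: ler_wpM2r; first by apply: sumr_ge0 => c _; apply: sqr_ge0.
    rewrite ler_pdivrMr ?mulr_gt0 ?exprn_gt0 //; nra.
  congr (_ * _); rewrite [LHS]big_seq_cond [RHS]big_seq; apply: eq_bigl => c.
  apply: andb_idr; rewrite mem_configs sum_nat_eq0 => /forallP c0; exact: (c0 z).
have [M Mpos ME] : exists2 M : nat, (0 < M)%N & M%:R = 4 * Q.
  by exists (4 * q.+1)%N; rewrite ?natrM.
pose t : R := 1 + (8 * Q)^-1.
have t0 : 0 < t by rewrite ltr_wpDr // invr_ge0 mulr_ge0 // ltW.
have M0 : 0 < M%:R :> R by rewrite ltr0n Mpos.
have := @killed_dirichlet_bound R n s M t phi z Mpos t0.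
set E := \sum_(c <- _) phi c * _ => bound.
rewrite -(ler_pM2l M0) mulrDr.
apply: le_trans (lerD bound (lexx _)).
(* All terms are now multiples of [phi c ^+ 2], so it is enough to compare coefficients for each
   [c]. *)
rewrite [X in _ + _ * (_ * X)]big_mkcond !mulr_sumr -sumrB -big_split /=.
rewrite big_seq [leRHS]big_seq; apply: ler_sum => c.
rewrite mem_configs => /eqP cs.
set V : R := (\sum_(y | _) minn (c y).+1 M)%:R.
set U : R := (\sum_(y | _) minn (c y) M)%:R.
(* There are at most [N * Q] particles and [M = 4 * Q], so [V - U >= N - 1 - N / 4], which is at
   least [N / 4] because [N >= 2]. *)
have VU : 4 * Q * (N - 1) + 4 * Q * U <= 4 * Q * V + N * Q.
  have := @sum_minnS n M c z Mpos; rewrite -(ler_nat R) !natrD !natrM cs -/U -/V ME.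
  rewrite (_ : n.-1%:R = N - 1); last by rewrite /N -subn1 natrB // ltnW.
  by move=> /le_trans; apply; rewrite lerD2l /N /Q -natrM ler_nat ltnW.
have UQ : U <= N * Q.
  rewrite -natrM ler_nat; apply: leq_trans (ltnW sn); rewrite -cs.
  rewrite [leqRHS](bigD1 z) //= (leq_trans _ (leq_addl _ _)) //.
  by apply: leq_sum => y _; apply: geq_minl.
have U0 : 0 <= U by apply: ler0n.
move: (sqr_ge0 (phi c)); move: (phi c ^+ 2) => p p0.
clearbody Q N U V.
rewrite !mulrA -mulrBl.
have -> : M%:R * N * (if c z == 0%N then p else 0)
  = (if c z == 0%N then M%:R * N else 0) * p.
  by case: ifP; rewrite ?mulr0 ?mul0r.
rewrite -mulrDl; apply: ler_wpM2r p0 _ _ _.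
have -> : M%:R * N / (512 * Q * Q) = N / (128 * Q).
  by rewrite ME; field; rewrite gt_eqF.
have -> : t - 1 = (8 * Q)^-1 by rewrite /t addrC addKr.
have lowK : N / (128 * Q) <= N / (72 * Q).
  by rewrite ler_pM2l ?lef_pV2 ?posrE; nra.
(* When [z] is empty, the killing coefficient [4 * Q * N] absorbs both the loss
   [(t - 1) * U <= N / 8] and the target. *)
case: posnP => [_|_] /=.
  rewrite add0r -lerBlDl opprK ME.
  have H1 : N / (128 * Q) <= N by rewrite ler_pdivrMr; nra.
  have H2 : (8 * Q)^-1 * U <= N by rewrite mulrC ler_pdivrMr; nra.
  nra.
rewrite addr0.
have -> : 1 - t^-1 = (8 * Q + 1)^-1.
  by rewrite /t; field; rewrite !gt_eqF //; nra.
apply: le_trans lowK _.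
(* When [z] is occupied, the numerator is [8 * Q * (V - U) - U >= 2 * N * Q - N * Q = N * Q]. With
   [8 * Q + 1 <= 9 * Q] this yields [N / (72 * Q)], more than the required [N / (128 * Q)]. *)
have -> : (8 * Q + 1)^-1 * V - (8 * Q)^-1 * U
  = (8 * Q * V - (8 * Q + 1) * U) / (8 * Q * (8 * Q + 1)).
  by field; rewrite !gt_eqF //; nra.
rewrite ler_pdivlMr; last by rewrite !mulr_gt0 //; nra.
have -> : N / (72 * Q) * (8 * Q * (8 * Q + 1)) = N * (8 * Q + 1) / 9.
  by field; rewrite gt_eqF.
have NQ : N * (8 * Q + 1) / 9 <= N * Q by rewrite ler_pdivrMr; nra.
nra.
Qed.

(** * From the killed process to the eigenvalues *)

Lemma sum_centered (R : realType) (n : nat) (f : 'I_n -> R) : (0 < n)%N ->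
  \sum_x (f x - n%:R^-1 * \sum_y f y) = 0.
Proof.
move=> n0; rewrite sumrB sumr_const card_ord -mulrnAl -[_^-1 *+ n]mulr_natl.
rewrite divff ?mul1r ?subrr //.
by rewrite pnatr_eq0 -lt0n.
Qed.

(** The jumps out of [addp c z] are split by whether their origin is already occupied in [c]. The
    only possible new origin is [z], when [c z = 0], and then the added particle itself moves. *)
Lemma zlap_addp (R : realType) (n : nat) (phi : config n -> R) (c : config n)
    (z : 'I_n) :
  zlap phi (addp c z) = zlap (fun d => phi (addp d z)) c
  + (if c z == 0%N then \sum_y (phi (addp c z) - phi (addp c y)) else 0).
Proof.
rewrite /zlap (bigID (fun x => 0 < c x)%N) /=; congr (_ + _).
  apply: eq_big => [x|x /andP[_ cx]].
    by rewrite ffunE; case: (c x) => [|k]; rewrite ?andbF ?andbT.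
  by apply: eq_bigr => y _; rewrite addp_remp // addpC.
case: ifPn => cz; last first.
  apply: big1 => x; rewrite ffunE -eqn0Ngt; case: eqVneq => [->|_] /andP[].
    by rewrite (negbTE cz).
  by rewrite addn0 lt0n => /negP.
rewrite (big_pred1 z) ?addpK // => x.
rewrite ffunE -eqn0Ngt /=; case: eqVneq => [->|_]; first by rewrite (eqP cz).
by rewrite addn0; case: (c x).
Qed.

Lemma zlap_eigenvalue_bound (R : realType) (n s q : nat) (lam : R)
    (phi : config n -> R) : (2 <= n)%N -> (s < n * q.+1)%N -> lam != 0 ->
  (exists2 c, c \in configs n s.+1 & phi c != 0) ->
  (forall c, c \in configs n s.+1 -> zlap phi c = n.-1%:R * (lam * phi c)) ->
  n%:R / (512 * q.+1%:R ^+ 2) <= n.-1%:R * lam.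
Proof.
move=> n2 sn lam0 [d ds phid] eig.
have n0 : (0 < n)%N by apply: ltnW.
pose u z c := phi (addp c z) - n%:R^-1 * \sum_y phi (addp c y).
have su c : \sum_z u z c = 0 by apply: sum_centered.
pose S := \sum_(c <- configs n s) \sum_z u z c ^+ 2.
have S0 : 0 <= S by apply: sumr_ge0 => c _; apply: sumr_ge0 => z _; apply: sqr_ge0.
have eq c : c \in configs n s -> n.-1%:R * lam * \sum_z u z c ^+ 2 =
    \sum_z (u z c * zlap (u z) c + n%:R * (if c z == 0%N then u z c ^+ 2 else 0)).
  move=> cs.
  pose g e := n%:R^-1 * \sum_y phi (addp e y).
  transitivity (\sum_z u z c * zlap phi (addp c z)).
    transitivity (\sum_z (n.-1%:R * lam * u z c ^+ 2 + n.-1%:R * lam * g c * u z c)).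
      by rewrite big_split /= -!mulr_sumr su mulr0 addr0.
    apply: eq_bigr => z _.
    rewrite eig; first by rewrite /u -/(g c); ring.
    by rewrite mem_configs sum_addp eqSS -mem_configs.
  (* Since [zlap g c] does not depend on [z] and the [u z c] sum to zero, subtracting it is free; it
     turns [zlap] of the shifted [phi] into [zlap (u z)]. *)
  transitivity (\sum_z (u z c * zlap phi (addp c z) - zlap g c * u z c)).
    by rewrite sumrB -mulr_sumr su mulr0 subr0.
  apply: eq_bigr => z _; rewrite zlap_addp.
  have -> : zlap (fun e => phi (addp e z)) c = zlap (u z) c + zlap g c.
    rewrite /zlap -big_split; apply: eq_bigr => x _; rewrite -big_split.
    by apply: eq_bigr => y _ /=; rewrite /u /g; ring.
  have -> : \sum_y (phi (addp c z) - phi (addp c y)) = n%:R * u z c.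
    rewrite sumrB sumr_const card_ord /u mulrBr mulrA divff ?mul1r ?mulr_natl //.
    by rewrite pnatr_eq0 -lt0n.
  by case: ifP => _; ring.
have Sle : n%:R / (512 * q.+1%:R ^+ 2) * S <= n.-1%:R * lam * S.
  have -> : n.-1%:R * lam * S = \sum_z (\sum_(c <- configs n s) u z c * zlap (u z) c
      + n%:R * \sum_(c <- configs n s | c z == 0%N) u z c ^+ 2).
    rewrite /S mulr_sumr big_seq (eq_bigr _ eq) -big_seq exchange_big.
    by apply: eq_bigr => z _ /=; rewrite big_split -mulr_sumr -big_mkcond.
  rewrite /S exchange_big mulr_sumr; apply: ler_sum => z _ /=.
  exact: killed_poincare.
(* If [S = 0], every [u z c] vanishes, so [phi] is unchanged by any jump and [zlap phi d = 0],
   contradicting [lam != 0] and [phi d != 0]. *)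
move: S0; rewrite le_eqVlt => /predU1P[S0|S0]; last by rewrite -(ler_pM2r S0).
have u0 c z : c \in configs n s -> u z c = 0.
  move=> cs; apply/eqP; rewrite -sqrf_eq0; apply/eqP/le_anti; rewrite sqr_ge0 andbT S0 /S.
  rewrite (bigD1_seq c) ?uniq_configs //= (bigD1 z) //= -addrA lerDl.
  by rewrite addr_ge0 // sumr_ge0 // => *; rewrite ?sumr_ge0 // => *; rewrite sqr_ge0.
have : zlap phi d = 0.
  apply: big1 => x dx; apply: big1 => y _.
  have rs : remp d x \in configs n s.
    by rewrite mem_configs -eqSS -(sum_addp _ x) rempK // -mem_configs.
  have : u x (remp d x) = u y (remp d x) by rewrite !u0.
  by rewrite /u => /addIr <-; rewrite rempK // subrr.
rewrite eig // => /eqP; rewrite !mulf_eq0 (negbTE lam0) (negbTE phid) !orbF.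
by rewrite pnatr_eq0; case: n n2 {d ds phid u S su S0 eq Sle u0 eig phi sn n0} => [|[]].
Qed.

(** * The relaxation time *)

Theorem theorem3 :
  exists C : Rdefinitions.R, 0 < C /\
    forall n r : nat, (2 <= n)%N -> (1 <= r)%N ->
      zrp_relaxation_time Rdefinitions.R n r
        <= C * (r%:R / n%:R + 1) ^+ 2.
Proof.
exists 512; split => // n [//|s] n2 _.
set R := Rdefinitions.R; set rho : R := _ / _.
have n0 : 0 < n%:R :> R by rewrite ltr0n ltnW.
have n1 : 0 < n.-1%:R :> R by rewrite ltr0n; case: n n2 {rho n0} => [|[]].
have rho0 : 0 <= rho by rewrite divr_ge0.
have C0 : 0 < 512 * (rho + 1) ^+ 2 by rewrite mulr_gt0 // exprn_gt0 // ltr_wpDl.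
rewrite /zrp_relaxation_time /zrp_spectral_gap; set A := (X in inf X).
have bnd lam : A lam -> (512 * (rho + 1) ^+ 2)^-1 <= lam.
  move=> [lam0 [f [[eta feta] eig]]].
  (* This extends [f] to all configurations: the sum has one term on the image of the injective
     [config_of] and none outside it. *)
  pose phi (c : config n) := \sum_(xi : zrp_state n s.+1 | config_of xi == c) f xi.
  have phiE xi : phi (config_of xi) = f xi.
    by rewrite /phi (big_pred1 xi) // => xi'; rewrite (inj_eq (@config_of_inj _ _)).
  have fE : f = phi \o @config_of n s.+1 by apply/funext => xi /=; rewrite phiE.
  (* This quotient meets both needs: [s < n * q.+1] for the eigenvalue bound, and [q.+1 <= rho + 1]
     for the final constant. *)
  pose q := (s %/ n)%N.
  have sq : (s < n * q.+1)%N by rewrite mulnC ltn_ceil // ltnW.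
  have H : n%:R / (512 * q.+1%:R ^+ 2) <= n.-1%:R * lam.
    apply: (@zlap_eigenvalue_bound R n s q lam phi) => //.
      exists (config_of eta); last by rewrite phiE.
      by apply: map_f; rewrite mem_enum.
    move=> c /mapP[xi _ ->]; rewrite phiE -eig fE zrp_generatorE.
    by rewrite mulrA divff ?mul1r // gt_eqF.
  have qrho : q.+1%:R <= rho + 1 :> R.
    rewrite -natr1 lerD2r ler_pdivlMr // -natrM ler_nat.
    by apply: leq_trans (leq_trunc_div _ _) (leqnSn _).
  have Q0 : 0 < 512 * q.+1%:R ^+ 2 :> R by rewrite mulr_gt0 // exprn_gt0.
  have lam_gt0 : 0 < lam.
    by rewrite -(pmulr_rgt0 _ n1) (lt_le_trans _ H) // divr_gt0.
  apply: (@le_trans _ _ (512 * q.+1%:R ^+ 2)^-1).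
    by rewrite lef_pV2 ?posrE // ler_pM2l // lerXn2r ?nnegrE // ltW // ltr_wpDl.
  (* As [lam > 0], the factor [n.-1] may be raised to [n], which then cancels. *)
  rewrite -(ler_pM2l n0) (le_trans H) // ler_pM2r // ler_nat.
  exact: leq_pred.
(* For an empty set of eigenvalues [inf] and the inverse both default to 0, and the bound is
   immediate. *)
have [->|A0] := eqVneq A set0; first by rewrite inf0 invr0 ltW.
have inf_ge : (512 * (rho + 1) ^+ 2)^-1 <= inf A.
  by apply: lb_le_inf; [apply/set0P | move=> lam /bnd].
rewrite -[leRHS]invrK lef_pV2 ?posrE ?invr_gt0 //.
by apply: lt_le_trans inf_ge; rewrite invr_gt0.
Qed.
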